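(* Let $H$ and $K$ be finite graphs. Let $G_1=H\cup K$ be formed so that $H$ and $K$ share exactly one vertex, and let $G_2=H\cup K$ be formed so that $H$ and $K$ are vertex-disjoint, so that $E(G_1)=E(G_2)=E(H)\cup E(K)$. Then (1) a set $\mathcal L$ of edge sets is a linear class of bonds of $G_1$ if and only if it is a linear class of bonds of $G_2$; and (2) for such $\mathcal L$, $J_0(G_1,\mathcal L)=J_0(G_2,\mathcal L)$ and $J(G_1,\mathcal L)=J(G_2,\mathcal L)$.
   Context: Graphs are finite, loops and multiple edges allowed. A bond is a minimal nonempty edge cut; $\delta(X)$ is the set of links with exactly one endpoint in a vertex set $X$. A tribond is $\delta(X_1)\cup\delta(X_2)\cup\delta(X_3)$ for a partition $\{X_1,X_2,X_3\}$ of the vertex set of one connected component into nonempty sets with each $G[X_i]$ connected and an edge joining each pair. A linear class of bonds is a set $\mathcal L$ of bonds such that for each such tripartition the number of $i$ with $\delta(X_i)\in\mathcal L$ is never exactly two; $\mathcal L$ is trivial if it contains every bond. A modular pair of bonds $B_1,B_2$ is one for which $G-(B_1\cup B_2)$ has two more components than $G$; a dibond is the union of a modular pair that is not a tribond. For non-trivial $\mathcal L$, $J_0(G,\mathcal L)$ is the matroid on $E(G)\cup\{e_0\}$ whose cocircuits are the bonds in $\mathcal L$, the sets $B\cup\{e_0\}$ for bonds $B\notin\mathcal L$, and the tribonds and dibonds containing no bond of $\mathcal L$; for trivial $\mathcal L$, $J_0(G,\mathcal L)$ is $M(G)$ with $e_0$ added as a loop. $J(G,\mathcal L)=J_0(G,\mathcal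 L)/e_0$. *)

(* Defs.v *)
From HB Require Import structures.
From mathcomp Require Import all_boot.

Set Implicit Arguments.
Unset Strict Implicit.
Unset Printing Implicit Defensive.

Definition matroid_axioms (E : finType) (I : {set {set E}}) : bool :=
  [&& set0 \in I,
      [forall A in I, forall B : {set E}, (B \subset A) ==> (B \in I)]
    & [forall A in I, forall B in I,
         (#|A| < #|B|) ==> [exists e in B :\: A, (e |: A) \in I]]].

Record matroid (E : finType) : Type :=
  Matroid { indep : {set {set E}}; indepP : matroid_axioms indep }.

HB.instance Definition _ (E : finType) := [isSub for @indep E].
HB.instance Definition _ (E : finType) := [Finite of matroid E by <:].

Lemma matroid_axiomsP (E : finType) (I : {set {set E}}) :
  reflect [/\ set0 \in I,
              forall A B : {set E}, A \in I -> B \subset A -> B \in I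
            & forall A B : {set E}, A \in I -> B \in I -> #|A| < #|B| ->
                exists2 e, e \in B :\: A & (e |: A) \in I]
          (matroid_axioms I).
Proof.
apply: (iffP and3P) => -[I0 Isub Iaug]; split=> //.
- by move=> A B AI BA; move/forall_inP: Isub => /(_ A AI)/forallP/(_ B)/implyP; apply.
- move=> A B AI BI ltAB.
  move/forall_inP: Iaug => /(_ A AI)/forall_inP/(_ B BI)/implyP/(_ ltAB).
  by case/exists_inP=> e; exists e.
- by apply/forall_inP=> A AI; apply/forallP=> B; apply/implyP; apply: Isub.
- apply/forall_inP=> A AI; apply/forall_inP=> B BI; apply/implyP=> ltAB.
  by apply/exists_inP; apply: Iaug.
Qed.

Lemma indep0 (E : finType) (M : matroid E) : set0 \in indep M.
Proof. by case/matroid_axiomsP: (indepP M). Qed.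

Lemma indepS (E : finType) (M : matroid E) (A B : {set E}) :
  A \in indep M -> B \subset A -> B \in indep M.
Proof. by case/matroid_axiomsP: (indepP M) => _ H _; apply: H. Qed.

Lemma indep_aug (E : finType) (M : matroid E) (A B : {set E}) :
  A \in indep M -> B \in indep M -> #|A| < #|B| ->
  exists2 e, e \in B :\: A & (e |: A) \in indep M.
Proof. by case/matroid_axiomsP: (indepP M) => _ _; apply. Qed.

Definition bases (E : finType) (M : matroid E) : {set {set E}} :=
  [set B | maxset (mem (indep M)) B].

Definition circuits (E : finType) (M : matroid E) : {set {set E}} :=
  [set C | minset [pred A | A \notin indep M] C].

Lemma indep_basis (E : finType) (M : matroid E) (A B : {set E}) :
  A \in indep M -> B \in indep M ->
  exists C : {set E}, [/\ A \subset C, C \subset A :|: B, C \in indep M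
                        & #|B| <= #|C|].
Proof.
move=> AI BI; have [n] := ubnP (#|B| - #|A|).
elim: n A AI => // n IHn A AI le_n.
have [leBA | ltAB] := leqP #|B| #|A|.
  by exists A; split=> //; apply: subsetUl.
have [e /setDP[eB eA] eAI] := indep_aug AI BI ltAB.
have [|C [sAC sCU CI leBC]] := IHn (e |: A) eAI.
  rewrite cardsU1 eA add1n subnS -ltnS prednK ?subn_gt0 //.
exists C; split=> //.
- by apply: subset_trans sAC; apply: subsetUr.
- apply: subset_trans sCU _; rewrite subUset subsetUr andbT subUset subsetUl andbT.
  by rewrite sub1set inE eB orbT.
Qed.

Lemma bases_indep (E : finType) (M : matroid E) (B : {set E}) :
  B \in bases M -> B \in indep M.
Proof. by rewrite inE => /maxsetp. Qed.

Lemma bases_max (E : finType) (M : matroid E) (A B : {set E}) :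
  B \in bases M -> A \in indep M -> #|A| <= #|B|.
Proof.
move=> BB AI; rewrite leqNgt; apply/negP=> ltBA.
have [e /setDP[_ eB] eBI] := indep_aug (bases_indep BB) AI ltBA.
move: BB; rewrite inE => /maxsetP[_ /(_ _ eBI (subsetUr _ _)) eq_eB].
by move: eB; rewrite -eq_eB setU11.
Qed.

Lemma card_bases (E : finType) (M : matroid E) (A B : {set E}) :
  B \in bases M -> A \in indep M -> #|B| <= #|A| -> A \in bases M.
Proof.
move=> BB AI leBA; rewrite inE; apply/maxsetP; split=> // C CI sAC.
apply/esym/eqP; rewrite eqEcard sAC /=.
exact: leq_trans (bases_max BB CI) leBA.
Qed.

Lemma basis_exists (E : finType) (M : matroid E) : exists B, B \in bases M.
Proof.
have [B maxB _] := @maxset_exists _ (mem (indep M)) set0 (indep0 M).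
by exists B; rewrite inE.
Qed.

Definition dual_indep (E : finType) (M : matroid E) : {set {set E}} :=
  [set A : {set E} | [exists B in bases M, [disjoint A & B]]].

Lemma dual_subproof (E : finType) (M : matroid E) :
  matroid_axioms (dual_indep M).
Proof.
apply/matroid_axiomsP; split.
- have [B BB] := basis_exists M; rewrite inE; apply/exists_inP; exists B => //.
  by rewrite -setI_eq0 set0I.
- move=> A B; rewrite !inE => /exists_inP[C CB dAC] sBA.
  by apply/exists_inP; exists C => //; apply: disjointWl dAC.
move=> X Y; rewrite !inE => /exists_inP[A AB dXA] /exists_inP[B BB dYB] ltXY.
have BXI : B :\: X \in indep M by apply: indepS (bases_indep BB) (subsetDl _ _).
have [C [sC sCU CI leAC]] := indep_basis BXI (bases_indep AB).
have CB := card_bases AB CI leAC.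
have dXC : [disjoint X & C].
  rewrite disjoint_sym; apply: disjointWl sCU _; rewrite -setI_eq0 setIUl setU_eq0 !setI_eq0.
  by rewrite [X in _ && X]disjoint_sym dXA andbT -setI_eq0 setIDAC setDIl setDv setI0.
have [sYC | /subsetPn[e eYX eC]] := boolP (Y :\: X \subset C); last first.
  exists e => //; rewrite inE; apply/exists_inP; exists C => //.
  rewrite -setI_eq0 setIUl setU_eq0 !setI_eq0 dXC andbT.
  by rewrite disjoints1.
have dd : [disjoint B :\: X & Y :\: X].
  by rewrite disjoint_sym; apply: disjointWl (subsetDl _ _) _; apply: disjointWr (subsetDl _ _) dYB.
have := subset_leq_card (_ : (B :\: X) :|: (Y :\: X) \subset C).
rewrite subUset sC sYC => /(_ isT).
rewrite cardsU (eqP (_ : _ :&: _ == set0)) ?setI_eq0 // cards0 subn0.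
have leCB := bases_max BB CI; move=> /leq_trans/(_ leCB).
have cB := cardsID X B; have cY := cardsID Y X; have cX := cardsID X Y.
have leBX : #|B :&: X| <= #|X :\: Y|.
  apply: subset_leq_card; rewrite subsetD subsetIr /= .
  by apply: disjointWl (subsetIl _ _) _; rewrite disjoint_sym.
rewrite -cB addnC leq_add2r => leYX.
have : #|Y| <= #|X|.
  rewrite -cX -cY setIC leq_add2l.
  exact: leq_trans leYX leBX.
by rewrite leqNgt ltXY.
Qed.

Definition dual (E : finType) (M : matroid E) : matroid E :=
  Matroid (dual_subproof M).

Definition cocircuits (E : finType) (M : matroid E) : {set {set E}} :=
  circuits (dual M).

Lemma circuits_inj (E : finType) : injective (@circuits E).
Proof.
move=> M N eqC; apply: val_inj => /=; apply/setP=> A.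
suff sub (P Q : matroid E) : circuits P = circuits Q ->
    A \in indep P -> A \in indep Q by apply/idP/idP; apply: sub.
move=> eqPQ AP; apply/negPn/negP=> nAQ.
have [C minC sCA] := @minset_exists _ [pred B | B \notin indep Q] A nAQ.
have : C \in circuits P by rewrite eqPQ inE.
by rewrite inE => /minsetp /=; rewrite (indepS AP sCA).
Qed.

Lemma dual_inj (E : finType) : injective (@dual E).
Proof.
move=> M N eqD; apply: val_inj => /=; apply/setP=> A.
suff sub (P Q : matroid E) : dual P = dual Q ->
    A \in indep P -> A \in indep Q by apply/idP/idP; apply: sub.
move=> eqPQ AP.
have [B maxB sAB] := @maxset_exists _ (mem (indep P)) A AP.
have BP : B \in bases P by rewrite inE.
have : ~: B \in indep (dual P).
  by rewrite inE; apply/exists_inP; exists B; rewrite // disjoints_subset.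
rewrite eqPQ inE => /exists_inP[C CQ]; rewrite disjoints_subset setCS => sCB.
have : ~: C \in indep (dual Q).
  by rewrite inE; apply/exists_inP; exists C; rewrite // disjoints_subset.
rewrite -eqPQ inE => /exists_inP[D DP]; rewrite disjoints_subset setCS => sDC.
have eqCB : C = B.
  apply/eqP; rewrite eqEcard sCB (leq_trans _ (subset_leq_card sDC)) //.
  exact: bases_max DP (bases_indep BP).
by apply: indepS sAB; rewrite -eqCB; apply: bases_indep.
Qed.

Lemma cocircuits_inj (E : finType) : injective (@cocircuits E).
Proof. by move=> M N /circuits_inj /dual_inj. Qed.

Lemma rank0_subproof (E : finType) : matroid_axioms [set (set0 : {set E})].
Proof.
apply/matroid_axiomsP; split=> [|A B|A B]; rewrite !inE //.
  by move=> /eqP->; rewrite subset0.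
by move=> /eqP-> /eqP->; rewrite ltnn.
Qed.

(** [the_matroid P] is the matroid satisfying [P].  It is only used for [P] that
    at most one matroid satisfies (see [circuits_inj], [cocircuits_inj]); the
    rank-zero matroid is the conventional value when there is none. *)
Definition the_matroid (E : finType) (P : pred (matroid E)) : matroid E :=
  odflt (Matroid (rank0_subproof E)) [pick M | P M].

Lemma the_matroid_eq (E : finType) (P : pred (matroid E)) (M : matroid E) :
  P M -> (forall N, P N -> N = M) -> the_matroid P = M.
Proof.
by move=> PM uM; rewrite /the_matroid; case: pickP => [N /uM //|/(_ M)]; rewrite PM.
Qed.

(** In [option E] the new element [e0] is [None]. *)
Definition lift_set (E : finType) (A : {set E}) : {set option E} :=
  [set Some e | e in A].

Definition add_loop_indep (E : finType) (M : matroid E) : {set {set option E}} :=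
  [set lift_set A | A in indep M].

Lemma card_lift_set (E : finType) (A : {set E}) : #|lift_set A| = #|A|.
Proof. by apply: card_imset; apply: Some_inj. Qed.

Lemma lift_setU1 (E : finType) (e : E) (A : {set E}) :
  lift_set (e |: A) = Some e |: lift_set A.
Proof. by rewrite /lift_set imsetU1. Qed.

Lemma lift_setS (E : finType) (A B : {set E}) :
  (lift_set A \subset lift_set B) = (A \subset B).
Proof.
apply/idP/idP => [/subsetP sAB|]; last exact: imsetS.
apply/subsetP=> e eA; have := sAB _ (imset_f Some eA).
by rewrite mem_imset //; apply: Some_inj.
Qed.

Lemma mem_lift_set (E : finType) (A : {set E}) (e : E) :
  (Some e \in lift_set A) = (e \in A).
Proof. by rewrite mem_imset //; apply: Some_inj. Qed.

Lemma None_lift_set (E : finType) (A : {set E}) : None \notin lift_set A.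
Proof. by apply/imsetP=> -[]. Qed.

Lemma add_loop_subproof (E : finType) (M : matroid E) :
  matroid_axioms (add_loop_indep M).
Proof.
apply/matroid_axiomsP; split.
- by apply/imsetP; exists set0; rewrite ?indep0 // /lift_set imset0.
- move=> _ B /imsetP[A AI ->] sBA.
  have eqB : B = lift_set [set e | Some e \in B].
    apply/setP=> -[e|]; first by rewrite mem_lift_set inE.
    rewrite (negbTE (None_lift_set _)); apply: contraNF (None_lift_set A).
    exact/subsetP.
  rewrite eqB; apply: imset_f; apply: indepS AI _.
  by rewrite -lift_setS -eqB.
- move=> _ _ /imsetP[A AI ->] /imsetP[B BI ->]; rewrite !card_lift_set => ltAB.
  have [e /setDP[eB eA] eAI] := indep_aug AI BI ltAB.
  exists (Some e); first by rewrite !inE !mem_lift_set eA.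
  by rewrite -lift_setU1 imset_f.
Qed.

Definition add_loop (E : finType) (M : matroid E) : matroid (option E) :=
  Matroid (add_loop_subproof M).

(** Contraction of [e0 = None]: when [e0] is not a loop, [A] is independent in
    [M / e0] iff [e0 |: A] is independent in [M]; when it is a loop,
    [M / e0 = M \ e0]. *)
Definition contract0_indep (E : finType) (M : matroid (option E)) : {set {set E}} :=
  [set A : {set E} | if [set None] \in indep M
                     then (None |: lift_set A) \in indep M
                     else lift_set A \in indep M].

Lemma contract0_subproof (E : finType) (M : matroid (option E)) :
  matroid_axioms (contract0_indep M).
Proof.
apply/matroid_axiomsP; split.
- by rewrite inE /lift_set imset0 setU0 indep0; case: ifP.
- move=> A B; rewrite !inE; case: ifP => _ AI sBA; apply: indepS AI _.
    by rewrite setUS // lift_setS.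
  by rewrite lift_setS.
- move=> A B; rewrite !inE; case: ifP => N0 AI BI ltAB.
    have [|x] := indep_aug AI BI.
      by rewrite !cardsU1 !None_lift_set !card_lift_set.
    case: x => [e|]; rewrite !inE //= !mem_lift_set => /andP[eA eB] eAI.
    exists e; first by rewrite inE eA.
    by rewrite inE N0 lift_setU1 setUCA.
  have [|x] := indep_aug AI BI; first by rewrite !card_lift_set.
  case: x => [e|]; rewrite !inE ?mem_lift_set ?(negbTE (None_lift_set _)) ?andbF //.
  by move=> eAB eAI; exists e; rewrite !inE ?N0 ?lift_setU1.
Qed.

Definition contract0 (E : finType) (M : matroid (option E)) : matroid E :=
  Matroid (contract0_subproof M).

(** The order of the two ends of an edge carries no meaning: every notion below
    is symmetric in [end1] and [end2]. *)
Record graph (V E : finType) : Type := Graph { end1 : E -> V; end2 : E -> V }.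

Definition adj (V E : finType) (G : graph V E) (F : {set E}) : rel V :=
  fun u v => [exists e in F, ((end1 G e == u) && (end2 G e == v))
                          || ((end1 G e == v) && (end2 G e == u))].

(** Components of the spanning subgraph with edge set [F]: vertices isolated in
    it count. *)
Definition ncomponents (V E : finType) (G : graph V E) (F : {set E}) : nat :=
  n_comp (adj G F) V.

Definition delta (V E : finType) (G : graph V E) (X : {set V}) : {set E} :=
  [set e | (end1 G e \in X) != (end2 G e \in X)].

Definition edge_cuts (V E : finType) (G : graph V E) : {set {set E}} :=
  [set delta G X | X : {set V}].

Definition bonds (V E : finType) (G : graph V E) : {set {set E}} :=
  [set B | minset [pred C | (C \in edge_cuts G) && (C != set0)] B].

Definition induced_connected (V E : finType) (G : graph V E) (X : {set V}) : bool :=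
  (X != set0) &&
  [forall u in X, forall v in X,
     connect (fun x y => [&& x \in X, y \in X & adj G setT x y]) u v].

Definition is_component (V E : finType) (G : graph V E) (X : {set V}) : bool :=
  [exists u, X == [set v | connect (adj G setT) u v]].

Definition joined (V E : finType) (G : graph V E) (X Y : {set V}) : bool :=
  [exists u in X, exists v in Y, adj G setT u v].

Definition tripartition (V E : finType) (G : graph V E) (X1 X2 X3 : {set V}) : bool :=
  [&& is_component G (X1 :|: X2 :|: X3),
      [&& [disjoint X1 & X2], [disjoint X1 & X3] & [disjoint X2 & X3]],
      [&& induced_connected G X1, induced_connected G X2 & induced_connected G X3]
    & [&& joined G X1 X2, joined G X1 X3 & joined G X2 X3]].

Definition tribonds (V E : finType) (G : graph V E) : {set {set E}} :=
  [set T | [exists X1, exists X2, exists X3,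
     tripartition G X1 X2 X3
     && (T == delta G X1 :|: delta G X2 :|: delta G X3)]].

Definition modular_pair (V E : finType) (G : graph V E) (B1 B2 : {set E}) : bool :=
  [&& B1 \in bonds G, B2 \in bonds G
    & ncomponents G (~: (B1 :|: B2)) == (ncomponents G setT).+2].

Definition dibonds (V E : finType) (G : graph V E) : {set {set E}} :=
  [set D | (D \notin tribonds G)
        && [exists B1, exists B2, modular_pair G B1 B2 && (D == B1 :|: B2)]].

(** The sum counts, as booleans in [nat], the [i] with [delta G Xi] in [L]. *)
Definition linear_class (V E : finType) (G : graph V E) (L : {set {set E}}) : Prop :=
  L \subset bonds G /\
  forall X1 X2 X3 : {set V}, tripartition G X1 X2 X3 ->
    (delta G X1 \in L) + (delta G X2 \in L) + (delta G X3 \in L) <> 2.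

Definition trivial_class (V E : finType) (G : graph V E) (L : {set {set E}}) : bool :=
  bonds G \subset L.

(** A loop counts twice. *)
Definition degree (V E : finType) (G : graph V E) (F : {set E}) (v : V) : nat :=
  #|[set e in F | end1 G e == v]| + #|[set e in F | end2 G e == v]|.

(** Edge sets of the nonempty connected 2-regular subgraphs; a vertex lies on
    the subgraph formed by [C] iff its degree in [C] is nonzero. *)
Definition cycles (V E : finType) (G : graph V E) : {set {set E}} :=
  [set C | [&& C != set0,
     [forall v, (degree G C v == 0) || (degree G C v == 2)]
   & [forall u, forall v, (degree G C u != 0) && (degree G C v != 0) ==>
        connect (adj G C) u v]]].

Definition cycle_matroid (V E : finType) (G : graph V E) : matroid E :=
  the_matroid [pred M | circuits M == cycles G].

Lemma cycle_matroid_eq (V E : finType) (G : graph V E) (M : matroid E) :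
  circuits M = cycles G -> cycle_matroid G = M.
Proof.
move=> eqM; apply: the_matroid_eq => [|N] /=; first exact/eqP.
by move/eqP; rewrite -eqM => /circuits_inj.
Qed.

Definition J0_cocircuits (V E : finType) (G : graph V E) (L : {set {set E}})
    : {set {set option E}} :=
  [set lift_set B | B in L]
  :|: [set None |: lift_set B | B in bonds G :\: L]
  :|: [set lift_set T | T in tribonds G :|: dibonds G
                      & [forall B in L, ~~ (B \subset T)]].

Definition J0 (V E : finType) (G : graph V E) (L : {set {set E}})
    : matroid (option E) :=
  if trivial_class G L then add_loop (cycle_matroid G)
  else the_matroid [pred M | cocircuits M == J0_cocircuits G L].

Lemma J0_eq (V E : finType) (G : graph V E) (L : {set {set E}})
    (M : matroid (option E)) :
  ~~ trivial_class G L -> cocircuits M = J0_cocircuits G L -> J0 G L = M.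
Proof.
rewrite /J0 => /negbTE-> eqM; apply: the_matroid_eq => [|N] /=; first exact/eqP.
by move/eqP; rewrite -eqM => /cocircuits_inj.
Qed.

Definition J (V E : finType) (G : graph V E) (L : {set {set E}}) : matroid E :=
  contract0 (J0 G L).

Definition disjoint_union (VH EH VK EK : finType)
    (H : graph VH EH) (K : graph VK EK) : graph (VH + VK)%type (EH + EK)%type :=
  Graph (fun e => match e with inl a => inl (end1 H a) | inr b => inr (end1 K b) end)
        (fun e => match e with inl a => inl (end2 H a) | inr b => inr (end2 K b) end).

(** The vertex [k] of [K] is identified with the vertex [h] of [H]; the vertices
    of the union are those of [H] and those of [K] other than [k]. *)
Definition glue_vertex (VH VK : finType) (h : VH) (k v : VK)
    : (VH + {x : VK | x != k})%type :=
  if insub v is Some w then inr w else inl h.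

Definition one_vertex_union (VH EH VK EK : finType)
    (H : graph VH EH) (K : graph VK EK) (h : VH) (k : VK)
    : graph (VH + {x : VK | x != k})%type (EH + EK)%type :=
  Graph (fun e => match e with
                  | inl a => inl (end1 H a)
                  | inr b => glue_vertex h k (end1 K b)
                  end)
        (fun e => match e with
                  | inl a => inl (end2 H a)
                  | inr b => glue_vertex h k (end2 K b)
                  end).

(* Main.v *)
(** Both graphs have the same edges, and the one-vertex union is the disjoint union
    with [h] and [k] identified, where [h] and [k] lie in different components.
    Identifying two such vertices changes no bond, since flipping an edge cut along
    one side makes it compatible with the identification; it lowers the number of
    components of every spanning subgraph by one, so it preserves modular pairs; a
    tripartition lives on one side, except that the part containing the merged
    vertex absorbs the other side; and a cycle cannot cross the merged vertex.
    Hence all the data defining [J0] agree. *)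

Require Import Defs.
From mathcomp Require Import all_boot.

Set Implicit Arguments.
Unset Strict Implicit.
Unset Printing Implicit Defensive.

(** * Adjacency, connectivity and components in a single graph *)

Section Adjacency.

Variables (V E : finType) (G : graph V E).
Implicit Types (F : {set E}) (X Y : {set V}).

Definition induced_adj X : rel V :=
  fun u v => [&& u \in X, v \in X & adj G setT u v].

Lemma adjP F u v :
  reflect (exists2 e, e \in F & (u = end1 G e /\ v = end2 G e) \/
                                (u = end2 G e /\ v = end1 G e))
          (adj G F u v).
Proof.
apply: (iffP exists_inP) => -[e eF].
  by case/orP=> /andP[/eqP<- /eqP<-]; exists e => //; [left | right].
by case=> -[-> ->]; exists e; rewrite // !eqxx ?orbT.
Qed.

Lemma adj_ends F e : e \in F -> adj G F (end1 G e) (end2 G e).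
Proof. by move=> eF; apply/adjP; exists e => //; left. Qed.

Lemma adj_sym F : symmetric (adj G F).
Proof.
by move=> u v; apply/adjP/adjP => -[e eF] [] [-> ->]; exists e => //; [right|left|right|left].
Qed.

Lemma induced_adj_ends X e :
  end1 G e \in X -> end2 G e \in X -> induced_adj X (end1 G e) (end2 G e).
Proof. by move=> e1 e2; rewrite /induced_adj e1 e2 adj_ends ?inE. Qed.

Lemma connect_adj_sym F : connect_sym (adj G F).
Proof. exact/sym_connect_sym/adj_sym. Qed.

Lemma connect_induced_sym X : connect_sym (induced_adj X).
Proof. by apply: sym_connect_sym => u v; rewrite /induced_adj adj_sym andbCA. Qed.

Lemma connect_map (T T' : finType) (R : rel T) (R' : rel T') (f : T -> T') :
  (forall u v, R u v -> connect R' (f u) (f v)) ->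
  forall u v, connect R u v -> connect R' (f u) (f v).
Proof.
move=> fR u _ /connectP[p pR ->]; elim: p u pR => //= v p IHp u /andP[uv /IHp].
by apply: connect_trans; apply: fR.
Qed.

(** Only the stored orientation of each edge has to be checked, since symmetry of [connect R]
    supplies the other. An edge may be sent to a whole [R]-path or to a single point; the
    retractions below do the latter. *)
Lemma connect_adj_map F (T : finType) (R : rel T) (f : V -> T) :
  connect_sym R ->
  (forall e, e \in F -> connect R (f (end1 G e)) (f (end2 G e))) ->
  forall u v, connect (adj G F) u v -> connect R (f u) (f v).
Proof.
move=> symR fR; apply: connect_map => _ _ /adjP[e eF [] [-> ->]]; first exact: fR.
by rewrite symR; apply: fR.
Qed.

Lemma connect_induced_map X (T : finType) (R : rel T) (f : V -> T) :
  connect_sym R ->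
  (forall e, end1 G e \in X -> end2 G e \in X ->
     connect R (f (end1 G e)) (f (end2 G e))) ->
  forall u v, connect (induced_adj X) u v -> connect R (f u) (f v).
Proof.
move=> symR fR; apply: connect_map => u v /and3P[uX vX /adjP[e _ uv]].
by case: uv uX vX => -[-> ->] e1 e2; [|rewrite symR]; apply: fR.
Qed.

Lemma connect_closed F X :
  (forall e, e \in F -> (end1 G e \in X) = (end2 G e \in X)) ->
  forall u v, connect (adj G F) u v -> (u \in X) = (v \in X).
Proof. by move=> clX; apply: closed_connect => _ _ /adjP[e eF [] [-> ->]]; rewrite clX. Qed.

(** Every prefix of a path from [u] ends in the component of [u], so the path never leaves it. *)
Lemma connect_induced u v :
  connect (adj G setT) u v ->
  connect (induced_adj [set x | connect (adj G setT) u x]) u v.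
Proof.
case/connectP=> p; elim/last_ind: p v => [|p w IHp] v /=; first by move=> _ ->.
rewrite rcons_path last_rcons => /andP[pP lw ->].
have lu : connect (adj G setT) u (last u p) by apply/connectP; exists p.
apply: connect_trans (IHp _ pP erefl) (connect1 _).
by rewrite /induced_adj !inE lu lw (connect_trans lu (connect1 lw)).
Qed.

Lemma induced_connectedP X :
  reflect ((exists x, x \in X) /\ {in X &, forall u v, connect (induced_adj X) u v})
          (induced_connected G X).
Proof.
apply: (iffP andP) => -[].
  move=> /set0Pn nX /forall_inP cX; split=> // u v uX vX.
  by have /forall_inP/(_ v vX) := cX u uX.
move=> nX cX; split; first exact/set0Pn.
by apply/forall_inP=> u uX; apply/forall_inP=> v vX; apply: cX.
Qed.

Lemma joinedP X Y :
  reflect (exists e, (end1 G e \in X /\ end2 G e \in Y) \/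
                     (end2 G e \in X /\ end1 G e \in Y))
          (joined G X Y).
Proof.
apply: (iffP exists_inP) => [[u uX /exists_inP[v vY /adjP[e _ uv]]]|[e [] [eX eY]]].
- by exists e; case: uv uX vY => -[-> ->] ? ?; [left | right].
- by exists (end1 G e) => //; apply/exists_inP; exists (end2 G e); rewrite ?adj_ends ?inE.
exists (end2 G e) => //; apply/exists_inP; exists (end1 G e) => //.
by rewrite adj_sym adj_ends ?inE.
Qed.

Lemma joined_sym X Y : joined G X Y = joined G Y X.
Proof. by apply/joinedP/joinedP => -[e [] [? ?]]; exists e; [right|left|right|left]. Qed.

Lemma componentP X :
  reflect (exists u, X = [set v | connect (adj G setT) u v]) (is_component G X).
Proof. by apply: (iffP existsP) => -[u /eqP]; exists u => //; apply/eqP. Qed.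

Lemma component_connect X u :
  is_component G X -> u \in X -> X = [set v | connect (adj G setT) u v].
Proof.
move=> /componentP[t ->]; rewrite inE => tu; apply/setP=> v; rewrite !inE.
exact: same_connect (connect_adj_sym _) _ _ tu v.
Qed.

Lemma component_closed X e :
  is_component G X -> (end1 G e \in X) = (end2 G e \in X).
Proof.
move=> /componentP[u ->]; rewrite !inE.
exact: same_connect_r (connect_adj_sym _) _ _ (connect1 (adj_ends (in_setT e))) u.
Qed.

End Adjacency.

(** * Identifying two vertices: connectivity, cuts and component counts *)

Section MergeVertices.

Variables (V V' E : finType) (G : graph V E) (G' : graph V' E).
Variables (phi : V -> V') (s : V' -> V).

(** [G'] is [G] with the vertices [a] and [b] identified, where [S] is a union of
    components of [G] that contains [a] but not [b]. *)
Record merge (S : {set V}) (a b : V) : Prop := Merge {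
  merge_end1 : forall e, end1 G' e = phi (end1 G e);
  merge_end2 : forall e, end2 G' e = phi (end2 G e);
  merge_sectionK : cancel s phi;
  merge_a : a \in S;
  merge_b : b \notin S;
  merge_ab : phi a = phi b;
  merge_fiber : forall u v, phi u = phi v ->
    [\/ u = v, u = a /\ v = b | u = b /\ v = a];
  merge_closed : forall e, (end1 G e \in S) = (end2 G e \in S) }.

(** Makes the two sides interchangeable: whatever is shown for [S] with base point [a] also holds
    for the complement with base point [b]. *)
Lemma merge_sym S a b : merge S a b -> merge (~: S) b a.
Proof.
case=> e1 e2 sK aS bS ab fib cl; split; rewrite ?inE ?negbK //.
  by move=> u v /fib[-> | [-> ->] | [-> ->]]; [constructor 1 | constructor 3 | constructor 2].
by move=> e; rewrite !inE cl.
Qed.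

(** [retr S a] collapses everything outside [S] to [a].  It factors through [phi],
    hence [retr S a \o s] retracts [G'] onto the copy of [S]. *)
Definition retr (S : {set V}) (a v : V) := if v \in S then v else a.

Section Sides.

Variables (S : {set V}) (a b : V).
Hypothesis M : merge S a b.

Let phiK := merge_sectionK M.
Let e1E := merge_end1 M.
Let e2E := merge_end2 M.
Let endsE := (e1E, e2E).

Lemma retr_in v : v \in S -> retr S a v = v.
Proof. by rewrite /retr => ->. Qed.

Lemma retr_out v : v \notin S -> retr S a v = a.
Proof. by rewrite /retr => /negbTE->. Qed.

Lemma mem_retr v : retr S a v \in S.
Proof. by rewrite /retr; case: ifP; rewrite ?(merge_a M). Qed.

(** Both [a] and [b] collapse to [a], as [b] lies off [S]; so the collapse is well defined on the
    vertices of [G']. *)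
Lemma retr_eq u v : phi u = phi v -> retr S a u = retr S a v.
Proof.
have ra := retr_in (merge_a M); have rb := retr_out (merge_b M).
by case/(merge_fiber M)=> [-> | [-> ->] | [-> ->]] //; rewrite ra rb.
Qed.

Lemma retr_section v : retr S a (s (phi v)) = retr S a v.
Proof. by apply: retr_eq; rewrite phiK. Qed.

(** No edge has ends on both sides of [S]: the retraction keeps the edges inside [S] and contracts
    those outside to the point [a]. *)
Lemma connect_retr F p q :
  connect (adj G' F) (phi p) (phi q) ->
  connect (adj G F) (retr S a p) (retr S a q).
Proof.
rewrite -(retr_section p) -(retr_section q) => pq.
apply: (connect_adj_map (f := fun x => retr S a (s x))) pq => [|e eF].
  exact: connect_adj_sym.
rewrite !endsE !retr_section /retr -(merge_closed M).
by case: ifP => // _; apply/connect1/adj_ends.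
Qed.

Lemma connect_merge F p q :
  connect (adj G F) p q -> connect (adj G' F) (phi p) (phi q).
Proof.
apply: connect_adj_map => [|e eF]; first exact: connect_adj_sym.
by rewrite -!endsE; apply/connect1/adj_ends.
Qed.

Lemma connect_side F u v : connect (adj G F) u v -> (u \in S) = (v \in S).
Proof. by apply: connect_closed => e _; apply: merge_closed M e. Qed.

Lemma delta_preim X : delta G' X = delta G (phi @^-1: X).
Proof. by apply/setP=> e; rewrite !inE !endsE. Qed.

(** Replacing a vertex set by its symmetric difference with [S] does not change
    its cut, and lets one assume that it does not separate [a] from [b]. *)
Lemma edge_cuts_merge : edge_cuts G' = edge_cuts G.
Proof.
apply/setP=> C; apply/imsetP/imsetP => -[X _ ->].
  by exists (phi @^-1: X); rewrite ?delta_preim.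
wlog abX: X / (a \in X) = (b \in X).
  move=> IH; have [/IH // | ab] := eqVneq (a \in X) (b \in X).
  pose Y := [set v | (v \in X) (+) (v \in S)].
  have -> : delta G X = delta G Y.
    apply/setP=> e; rewrite !inE (merge_closed M).
    by case: (end1 G e \in X); case: (end2 G e \in X); case: (_ \in S).
  apply: IH; rewrite !inE (merge_a M) (negbTE (merge_b M)).
  by case: (a \in X) (b \in X) ab => [] [].
(* The image of [X] pulls back to [X] itself: the only fibre with two elements is that of [a] and
   [b], which [X] does not separate. *)
exists [set phi v | v in X] => //; rewrite delta_preim; congr delta.
apply/setP=> v; rewrite inE; apply/idP/imsetP => [vX | [u uX]]; first by exists v.
by case/(merge_fiber M)=> [-> | [-> uE] | [-> uE]] //; [rewrite abX -uE | rewrite -abX -uE].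
Qed.

Lemma bonds_merge : bonds G' = bonds G.
Proof. by rewrite /bonds edge_cuts_merge. Qed.

End Sides.

(** The components of [G] other than that of [b] correspond to those of [G']. *)
Lemma ncomponents_merge S a b F :
  merge S a b -> ncomponents G F = (ncomponents G' F).+1.
Proof.
move=> M; have M' := merge_sym M.
have cG := connect_adj_sym G F; have cG' := connect_adj_sym G' F.
pose R := [set v | roots (adj G F) v]; pose R' := [set v | roots (adj G' F) v].
have -> : ncomponents G F = #|R| by apply: eq_card => v; rewrite !inE andbT.
have -> : ncomponents G' F = #|R'| by apply: eq_card => v; rewrite !inE andbT.
pose rb := root (adj G F) b.
have rbR : rb \in R by rewrite inE roots_root.
rewrite (cardsD1 rb) rbR add1n; congr _.+1.
pose f v := root (adj G' F) (phi v).
(* Retract a connection between the images to both sides. For roots on the same side one retraction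
   connects them in [G]; for roots on opposite sides the root off [S] would be connected to [b], and
   its component has been removed. *)
have injf : {in R :\ rb &, injective f}.
  move=> u v; rewrite !inE => /andP[urb /eqP uR] /andP[vrb /eqP vR].
  move/(rootP cG') => uv; rewrite -uR -vR; apply/(rootP cG).
  have := connect_retr M uv; have := connect_retr M' uv.
  rewrite /retr !inE; case: (u \in S); case: (v \in S) => //=.
    by move=> bv; case/negP: vrb; rewrite -vR /rb root_connect // cG.
  by move=> ub; case/negP: urb; rewrite -uR /rb root_connect.
rewrite -(card_in_imset injf); apply: eq_card => x; rewrite !inE.
apply/imsetP/idP => [[v _ ->] | /eqP xR]; first exact: roots_root.
have [e|n] := eqVneq (root (adj G F) (s x)) rb; last first.
  exists (root (adj G F) (s x)); first by rewrite !inE n roots_root.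
  rewrite -{1}xR /f; apply/(rootP cG'); rewrite -{1}(merge_sectionK M x).
  exact: (connect_merge M (connect_root _ _)).
(* The section may land in the removed component of [b]; the component of [a] has the same image
   there and differs from it, because [S] separates [a] from [b]. *)
exists (root (adj G F) a).
  rewrite !inE roots_root // andbT root_connect //; apply/negP=> /(connect_side M).
  by rewrite (merge_a M) (negbTE (merge_b M)).
rewrite -{1}xR /f; apply/(rootP cG'); rewrite -{1}(merge_sectionK M x).
apply: (@connect_trans _ _ (phi b)); first exact: (connect_merge M (introT (rootP cG) e)).
by rewrite -(merge_ab M); exact: (connect_merge M (connect_root _ _)).
Qed.

(** * Transfer of tripartitions across the identification *)

Definition pull (S : {set V}) (X : {set V'}) : {set V} :=
  [set v | (v \in S) && (phi v \in X)].

(** Equivalently, [X] contains the merged vertex or has no vertex off [S]. This form covers both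
    cases at once and says that the retraction maps [X] into itself. *)
Definition stable (S : {set V}) (a : V) (X : {set V'}) : Prop :=
  forall v, phi v \in X -> phi (retr S a v) \in X.

(** The cells are enlarged by the vertices of the component [U] of [G'] lying off
    [S], which are all given to the cell that contains [a]. *)
Definition push (S : {set V}) (a : V) (U : {set V'}) (Y : {set V}) : {set V'} :=
  [set x | (x \in U) && (retr S a (s x) \in Y)].

Section Tripartitions.

Variables (S : {set V}) (a b : V).
Hypothesis M : merge S a b.

Let phiK := merge_sectionK M.
Let endsE := (merge_end1 M, merge_end2 M).
Let retr_sec := retr_section M.

Lemma stable_inside (X : {set V'}) : (forall v, phi v \in X -> v \in S) -> stable S a X.
Proof. by move=> XS v vX; rewrite retr_in ?XS. Qed.

Lemma stable_merged (X : {set V'}) : phi a \in X -> stable S a X.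
Proof. by move=> aX v vX; rewrite /retr; case: ifP. Qed.

Lemma stableU (X Y : {set V'}) : stable S a X -> stable S a Y -> stable S a (X :|: Y).
Proof. by move=> sX sY v; rewrite !inE => /orP[/sX | /sY] ->; rewrite ?orbT. Qed.

Lemma pullU (X Y : {set V'}) : pull S (X :|: Y) = pull S X :|: pull S Y.
Proof. by apply/setP=> v; rewrite !inE -andb_orr. Qed.

Lemma pull_disjoint (X Y : {set V'}) : [disjoint X & Y] -> [disjoint pull S X & pull S Y].
Proof.
rewrite -!setI_eq0 => /eqP XY; apply/eqP/setP=> v; rewrite !inE.
by move/setP/(_ (phi v)): XY; rewrite !inE; case: (v \in S).
Qed.

(** The retraction turns paths within [X] into paths within its trace on [S]; stability places a
    retracted vertex in the trace, which is thus nonempty. *)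
Lemma induced_connected_pull X :
  stable S a X -> induced_connected G' X -> induced_connected G (pull S X).
Proof.
move=> sX /induced_connectedP[[x xX] cX]; apply/induced_connectedP; split.
  exists (retr S a (s x)); rewrite inE (mem_retr M) /=.
  by apply: sX; rewrite phiK.
move=> u v; rewrite !inE => /andP[uS uX] /andP[vS vX].
rewrite -(retr_in a uS) -(retr_in a vS) -(retr_sec u) -(retr_sec v).
apply: (connect_induced_map (f := fun x => retr S a (s x))) (cX _ _ uX vX).
  exact: connect_induced_sym.
move=> e; rewrite !endsE !retr_sec /retr -(merge_closed M) => pX qX.
case: ifP => // pS; apply/connect1/induced_adj_ends; rewrite inE ?pX ?qX ?pS //.
by rewrite -(merge_closed M) pS.
Qed.

(** If the joining edge were off [S], stability would put the merged vertex in both [X] and [Y]. *)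
Lemma joined_pull X Y :
  stable S a X -> stable S a Y -> [disjoint X & Y] ->
  joined G' X Y -> joined G (pull S X) (pull S Y).
Proof.
move=> sX sY dXY /joinedP[e]; rewrite !endsE => XY.
have [pS|nS] := boolP (end1 G e \in S).
  apply/joinedP; exists e; rewrite !inE -(merge_closed M) pS /=.
  by case: XY; [left | right].
have nS2 : end2 G e \notin S by rewrite -(merge_closed M).
suff [aX aY] : phi a \in X /\ phi a \in Y.
  by move: dXY => /disjointFr/(_ aX); rewrite aY.
by case: XY => -[/sX + /sY]; rewrite !retr_out.
Qed.

Lemma is_component_pull U v :
  is_component G' U -> v \in pull S U -> is_component G (pull S U).
Proof.
move=> cU; rewrite inE => /andP[vS vU]; apply/componentP; exists v.
apply/setP=> u; rewrite !inE (component_connect cU vU) inE.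
apply/andP/idP => [[uS] | vu].
  by move/(connect_retr M); rewrite !retr_in.
by rewrite -(connect_side M vu) (connect_merge M vu).
Qed.

(** Here [Y] stands for the union of the other two cells. An edge off [S] cannot leave [X]: its
    other end would lie in [Y], and stability would put the merged vertex in both sets. *)
Lemma delta_pull X Y :
  is_component G' (X :|: Y) -> [disjoint X & Y] -> stable S a X -> stable S a Y ->
  delta G (pull S X) = delta G' X.
Proof.
move=> cXY dXY sX sY.
suff XE p q : p \notin S -> q \notin S -> (phi p \in X :|: Y) = (phi q \in X :|: Y) ->
    phi p \in X -> phi q \in X.
  apply/setP=> e; rewrite !inE !endsE -(merge_closed M).
  have := component_closed e cXY; rewrite !endsE => eU.
  have [//|nS1] := boolP (end1 G e \in S).
  have nS2 : end2 G e \notin S by rewrite -(merge_closed M).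
  rewrite eqxx (_ : (phi (end1 G e) \in X) = (phi (end2 G e) \in X)) ?eqxx //.
  by apply/idP/idP; apply: XE.
move=> pS qS pqU pX; have := sX _ pX; rewrite retr_out // => aX.
move: pqU; rewrite !inE pX => /esym/orP[//|/sY]; rewrite retr_out // => aY.
by move: dXY => /disjointFr/(_ aX); rewrite aY.
Qed.

Lemma tripartition_pull X1 X2 X3 :
  stable S a X1 -> stable S a X2 -> stable S a X3 -> tripartition G' X1 X2 X3 ->
  [/\ tripartition G (pull S X1) (pull S X2) (pull S X3),
      delta G (pull S X1) = delta G' X1, delta G (pull S X2) = delta G' X2
    & delta G (pull S X3) = delta G' X3].
Proof.
move=> s1 s2 s3 /and4P[cU /and3P[d12 d13 d23] /and3P[c1 c2 c3] /and3P[j12 j13 j23]].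
have cp1 := induced_connected_pull s1 c1.
split; last 3 first.
- apply: (@delta_pull _ (X2 :|: X3)) => //; first by rewrite setUA.
    by rewrite disjoint_sym disjoints_subset subUset -!disjoints_subset
               disjoint_sym d12 disjoint_sym.
  exact: stableU.
- apply: (@delta_pull _ (X1 :|: X3)) => //; first by rewrite setUCA setUA.
    by rewrite disjoint_sym disjoints_subset subUset -!disjoints_subset
               d12 disjoint_sym.
  exact: stableU.
- apply: (@delta_pull _ (X1 :|: X2)) => //; first by rewrite setUC.
    by rewrite disjoint_sym disjoints_subset subUset -!disjoints_subset d13.
  exact: stableU.
apply/and4P; split; last 3 first.
- by rewrite !pull_disjoint.
- by rewrite cp1 !induced_connected_pull.
- by rewrite !joined_pull.
case/induced_connectedP: cp1 => -[v v1] _; rewrite -!pullU.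
by apply: (is_component_pull cU (v := v)); move: v1; rewrite !inE => /andP[-> ->].
Qed.

Lemma pushU U Y Z : push S a U (Y :|: Z) = push S a U Y :|: push S a U Z.
Proof. by apply/setP=> x; rewrite !inE -andb_orr. Qed.

Lemma push_disjoint (U : {set V'}) (Y Z : {set V}) :
  [disjoint Y & Z] -> [disjoint push S a U Y & push S a U Z].
Proof.
rewrite -!setI_eq0 => /eqP YZ; apply/eqP/setP=> x; rewrite !inE.
by move/setP/(_ (retr S a (s x))): YZ; rewrite !inE; case: (x \in U).
Qed.

Section Push.

Variables (U : {set V'}) (Y : {set V}).
Hypothesis cU : is_component G' U.
Hypothesis YS : Y \subset S.
Hypothesis YU : {in Y, forall v, phi v \in U}.

Lemma mem_push v : v \in Y -> phi v \in push S a U Y.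
Proof. by move=> vY; rewrite inE YU // retr_sec retr_in ?(subsetP YS). Qed.

(** Reduces connectivity of the pushed cell to that of [Y]. A vertex off [S] is in the cell only if
    [a] is in [Y], and then it reaches the merged vertex through vertices off [S], all of which in
    [U] belong to the cell. *)
Lemma connect_push x :
  x \in push S a U Y ->
  connect (induced_adj G' (push S a U Y)) x (phi (retr S a (s x))).
Proof.
rewrite inE => /andP[xU]; have [xS _|xS] := boolP (s x \in S).
  by rewrite retr_in // phiK.
rewrite retr_out // => aY.
have M' := merge_sym M.
(* [g] collapses the side [S] of [G'] to the merged vertex, so a path in [U] from that vertex to [x]
   becomes one inside the pushed cell. *)
rewrite connect_induced_sym; pose g x := phi (retr (~: S) b (s x)).
have -> : phi a = g (phi a).
  by rewrite /g (retr_section M') retr_out ?inE ?(merge_a M) // (merge_ab M).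
have -> : x = g x by rewrite /g retr_in ?phiK // inE.
have UE := component_connect cU (YU aY).
have ax : connect (adj G' setT) (phi a) x by rewrite UE inE in xU.
apply: (connect_induced_map (f := g)) (connect_induced ax) => [|e].
  exact: connect_induced_sym.
rewrite -UE !endsE /g !(retr_section M') /retr !inE -(merge_closed M) => pU qU.
case: ifP => //= pS; rewrite -!endsE.
by apply/connect1/induced_adj_ends; rewrite !endsE inE ?pU ?qU retr_sec retr_out //
  -?(merge_closed M).
Qed.

Lemma induced_connected_push : induced_connected G Y -> induced_connected G' (push S a U Y).
Proof.
case/induced_connectedP=> -[y yY] cY; apply/induced_connectedP; split.
  by exists (phi y); apply: mem_push.
move=> u v uP vP; apply: connect_trans (connect_push uP) _.
rewrite connect_induced_sym; apply: connect_trans (connect_push vP) _.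
move: uP vP; rewrite !inE => /andP[_ uY] /andP[_ vY].
apply: (connect_induced_map (f := phi)) (cY _ _ vY uY) => [|e pY qY].
  exact: connect_induced_sym.
by rewrite -!endsE; apply/connect1/induced_adj_ends; rewrite !endsE mem_push.
Qed.

(** Both ends of an edge off [S] retract to [a] and lie in [U] together or not at all, so the edge
    is in neither cut. *)
Lemma delta_push : delta G' (push S a U Y) = delta G Y.
Proof.
apply/setP=> e; rewrite !inE.
have := component_closed e cU; rewrite !endsE !retr_sec => eU.
have [pS|pS] := boolP (end1 G e \in S); have qS := pS; rewrite (merge_closed M) in qS.
  rewrite !retr_in //; congr (_ != _).
    by apply: andb_idl => /YU.
  by apply: andb_idl => /YU.
rewrite !retr_out // eU eqxx.
by rewrite !(contraNF (subsetP YS _)).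
Qed.

End Push.

Lemma joined_push (U : {set V'}) (Y Z : {set V}) :
  Y \subset S -> {in Y, forall v, phi v \in U} ->
  Z \subset S -> {in Z, forall v, phi v \in U} ->
  joined G Y Z -> joined G' (push S a U Y) (push S a U Z).
Proof.
move=> YS YU ZS ZU /joinedP[e YZ]; apply/joinedP; exists e; rewrite !endsE.
by case: YZ => -[pY qZ]; [left | right]; rewrite !mem_push.
Qed.

Lemma tripartition_push (Y1 Y2 Y3 : {set V}) :
  Y1 \subset S -> tripartition G Y1 Y2 Y3 ->
  exists X1 X2 X3,
    [/\ tripartition G' X1 X2 X3, delta G' X1 = delta G Y1,
        delta G' X2 = delta G Y2 & delta G' X3 = delta G Y3].
Proof.
move=> Y1S /and4P[cW /and3P[d12 d13 d23] /and3P[c1 c2 c3] /and3P[j12 j13 j23]].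
have [[v v1] _] := induced_connectedP _ _ c1.
set W := Y1 :|: Y2 :|: Y3 in cW.
have vW : v \in W by rewrite !inE v1.
have WE := component_connect cW vW.
have vS := subsetP Y1S v v1.
(* A component lies on one side, so the first cell forces the other two into [S]. *)
have WS : W \subset S.
  by apply/subsetP=> u; rewrite WE inE => /(connect_side M) <-.
pose U := [set x | connect (adj G' setT) (phi v) x].
have cU : is_component G' U by apply/componentP; exists (phi v).
have WU : {in W, forall u, phi u \in U}.
  by move=> u; rewrite WE !inE => /(connect_merge M).
have YWP (Y : {set V}) : Y \subset W -> Y \subset S /\ {in Y, forall u, phi u \in U}.
  move=> YW; split; first exact: subset_trans YW WS.
  by move=> u /(subsetP YW)/WU.
have [|S1 U1] := YWP Y1; first by rewrite /W -setUA subsetUl.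
have [|S2 U2] := YWP Y2; first by rewrite /W setUAC subsetUr.
have [|S3 U3] := YWP Y3; first by rewrite /W subsetUr.
exists (push S a U Y1), (push S a U Y2), (push S a U Y3).
split; rewrite ?delta_push //; apply/and4P; split.
(* The pushed cells fill [U]: retracting a path from [phi v] gives a path from [v] in [G], which
   ends in the component [W]. *)
- rewrite -!pushU -/W (_ : push _ _ _ _ = U) //.
  apply/setP=> x; rewrite inE; apply: andb_idr; rewrite inE => vx.
  rewrite WE inE -{1}(retr_in a vS); apply: (connect_retr M).
  by rewrite phiK.
- by rewrite !push_disjoint.
- by rewrite !induced_connected_push.
by rewrite !joined_push.
Qed.

End Tripartitions.

(** A connected set avoiding the merged vertex lifts injectively along [phi], and its edges do not
    cross between the sides, so it lies on one side. A set containing the merged vertex is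
    stable. *)
Lemma stable_or_off S a b (X : {set V'}) :
  merge S a b -> induced_connected G' X ->
  stable S a X \/ forall v, phi v \in X -> v \notin S.
Proof.
move=> M /induced_connectedP[[x xX] cX].
have [aX | aX] := boolP (phi a \in X); first by left; apply: stable_merged.
have sphi v : phi v \in X -> s (phi v) = v.
  move=> vX; apply/esym; case: (merge_fiber M (esym (merge_sectionK M (phi v)))) => //.
    by case=> va; rewrite -va vX in aX.
  by case=> vb; rewrite (merge_ab M) -vb vX in aX.
have side y : y \in X -> (s x \in S) = (s y \in S).
  move=> yX; apply: (@closed_connect _ (induced_adj G' X) [pred z | s z \in S]) (cX _ _ xX yX).
  move=> u v /and3P[uX vX /adjP[e _ uv]] /=; move: uv uX vX; rewrite (merge_end1 M) (merge_end2 M).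
  by case=> -[-> ->] pX qX; rewrite ?inE !sphi // (merge_closed M).
have [xS | xS] := boolP (s x \in S).
  by left; apply: stable_inside => v vX; rewrite -(sphi v vX) -side.
by right=> v vX; rewrite -(sphi v vX) -side.
Qed.

(** The joining edge has an end off [S] in [X], hence its end in [Y] is off [S] too; this excludes
    that [Y] lies wholly on the side [S]. *)
Lemma joined_stable S a b (X Y : {set V'}) :
  merge S a b -> joined G' X Y -> (forall v, phi v \in X -> v \notin S) ->
  induced_connected G' Y -> stable (~: S) b Y.
Proof.
move=> M /joinedP[e]; rewrite (merge_end1 M) (merge_end2 M) => XY offX.
case/(stable_or_off (merge_sym M))=> // offY.
have cl := merge_closed M e.
by case: XY => -[/offX + /offY]; rewrite inE negbK cl => /negbTE->.
Qed.

(** The parts avoiding the merged vertex lie on one side of it, the same for all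
    of them since any two parts are joined; that side carries the tripartition. *)
Lemma tripartition_merge S a b (X1 X2 X3 : {set V'}) :
  merge S a b -> tripartition G' X1 X2 X3 ->
  exists Y1 Y2 Y3,
    [/\ tripartition G Y1 Y2 Y3, delta G Y1 = delta G' X1,
        delta G Y2 = delta G' X2 & delta G Y3 = delta G' X3].
Proof.
move=> M T; have M' := merge_sym M.
have pulled S1 a1 b1 : merge S1 a1 b1 -> stable S1 a1 X1 -> stable S1 a1 X2 ->
    stable S1 a1 X3 -> exists Y1 Y2 Y3,
      [/\ tripartition G Y1 Y2 Y3, delta G Y1 = delta G' X1,
          delta G Y2 = delta G' X2 & delta G Y3 = delta G' X3].
  move=> M1 s1 s2 s3; exists (pull S1 X1), (pull S1 X2), (pull S1 X3).
  exact: tripartition_pull M1 _ _ _ s1 s2 s3 T.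
have /and4P[_ _ /and3P[c1 c2 c3] /and3P[j12 j13 j23]] := T.
have inside (X : {set V'}) : (forall v, phi v \in X -> v \notin S) -> stable (~: S) b X.
  by move=> off; apply: stable_inside => v /off; rewrite inE.
case: (stable_or_off M c1) => [s1 | o1]; last first.
  by apply: (pulled _ _ _ M'); [exact: inside | exact: joined_stable M j12 o1 c2
                               | exact: joined_stable M j13 o1 c3].
case: (stable_or_off M c2) => [s2 | o2]; last first.
  apply: (pulled _ _ _ M'); [|exact: inside | exact: joined_stable M j23 o2 c3].
  by apply: joined_stable M _ o2 c1; rewrite joined_sym.
case: (stable_or_off M c3) => [s3 | o3]; last first.
  apply: (pulled _ _ _ M'); [| |exact: inside].
    by apply: joined_stable M _ o3 c1; rewrite joined_sym.
  by apply: joined_stable M _ o3 c2; rewrite joined_sym.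
exact: pulled M s1 s2 s3.
Qed.

(** The first cell is connected in [G], so it lies on one side; [merge_sym] allows that side to be
    called [S]. *)
Lemma tripartition_unmerge S a b (Y1 Y2 Y3 : {set V}) :
  merge S a b -> tripartition G Y1 Y2 Y3 ->
  exists X1 X2 X3,
    [/\ tripartition G' X1 X2 X3, delta G' X1 = delta G Y1,
        delta G' X2 = delta G Y2 & delta G' X3 = delta G Y3].
Proof.
move=> M T; have /and4P[_ _ /and3P[/induced_connectedP[[v vY] cY] _ _] _] := T.
have side u : u \in Y1 -> (v \in S) = (u \in S).
  move=> uY; apply: (connect_side M (F := setT)).
  apply: (connect_induced_map (f := id)) (cY _ _ vY uY) => [|e _ _].
    exact: connect_adj_sym.
  by apply/connect1/adj_ends; rewrite inE.
have [vS | vS] := boolP (v \in S).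
  by apply: (tripartition_push M) T; apply/subsetP=> u /side <-.
by apply: (tripartition_push (merge_sym M)) T; apply/subsetP=> u /side; rewrite inE => <-.
Qed.

(** * Invariance of tribonds, dibonds and linear classes *)

Lemma tribonds_merge S a b : merge S a b -> tribonds G' = tribonds G.
Proof.
move=> M; apply/setP=> D; rewrite !inE.
apply/existsP/existsP => -[X1 /existsP[X2 /existsP[X3 /andP[T /eqP->]]]].
  have [Y1 [Y2 [Y3 [TY <- <- <-]]]] := tripartition_merge M T.
  by exists Y1; apply/existsP; exists Y2; apply/existsP; exists Y3; rewrite TY eqxx.
have [Y1 [Y2 [Y3 [TY <- <- <-]]]] := tripartition_unmerge M T.
by exists Y1; apply/existsP; exists Y2; apply/existsP; exists Y3; rewrite TY eqxx.
Qed.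

Lemma dibonds_merge S a b : merge S a b -> dibonds G' = dibonds G.
Proof.
move=> M; apply/setP=> D; rewrite [LHS]inE [RHS]inE (tribonds_merge M); congr (_ && _).
apply: eq_existsb => B1; apply: eq_existsb => B2; rewrite /modular_pair.
by rewrite (bonds_merge M) !(ncomponents_merge _ M) eqSS.
Qed.

Lemma linear_class_merge S a b (L : {set {set E}}) :
  merge S a b -> linear_class G' L <-> linear_class G L.
Proof.
move=> M; rewrite /linear_class (bonds_merge M).
split=> -[LB LT]; split=> // X1 X2 X3.
  by move/(tripartition_unmerge M)=> [Y1 [Y2 [Y3 [/LT + <- <- <-]]]].
by move/(tripartition_merge M)=> [Y1 [Y2 [Y3 [/LT + <- <- <-]]]].
Qed.

End MergeVertices.

(** * Degrees and cycles *)

Lemma card_preim_sum (E V : finType) (f : E -> V) (C : {set E}) (P : pred V) :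
  \sum_(v | P v) #|[set e in C | f e == v]| = #|[set e in C | P (f e)]|.
Proof.
rewrite -sum1_card (partition_big f P) => [|e]; last by rewrite inE => /andP[].
apply: eq_bigr => v Pv; rewrite -sum1_card; apply: eq_bigl => e; rewrite !inE.
by case: eqVneq => [->|]; rewrite ?Pv ?andbT ?andbF.
Qed.

Lemma degree_ends (V E : finType) (G : graph V E) (C : {set E}) e :
  e \in C -> degree G C (end1 G e) != 0 /\ degree G C (end2 G e) != 0.
Proof.
move=> eC; rewrite /degree !addn_eq0 !negb_and !cards_eq0.
by split; apply/orP; [left | right]; apply/set0Pn; exists e; rewrite inE eC eqxx.
Qed.

Lemma degree_connect (V E : finType) (G : graph V E) (C : {set E}) u v :
  connect (adj G C) u v -> degree G C u != 0 -> degree G C v != 0.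
Proof.
move=> uv; have := @connect_closed _ _ G C [set w | degree G C w != 0].
move=> /(_ _ u v uv); rewrite !inE => -> // e /(degree_ends G)[].
by rewrite !inE => -> ->.
Qed.

Lemma cyclesP (V E : finType) (G : graph V E) (C : {set E}) :
  reflect [/\ C != set0, forall v, degree G C v = 0 \/ degree G C v = 2
            & forall u v, degree G C u != 0 -> degree G C v != 0 ->
                connect (adj G C) u v]
          (C \in cycles G).
Proof.
rewrite inE; apply: (iffP and3P) => -[nC dC cC]; split=> //.
- by move=> v; have /orP[/eqP | /eqP] := forallP dC v; [left | right].
- by move=> u v du dv; have /forallP/(_ v)/implyP := forallP cC u; apply; rewrite du.
- by apply/forallP=> v; case: (dC v) => ->.
by apply/forallP=> u; apply/forallP=> v; apply/implyP=> /andP[]; apply: cC.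
Qed.

Section MergeCycles.

Variables (V V' E : finType) (G : graph V E) (G' : graph V' E).
Variables (phi : V -> V') (s : V' -> V) (S : {set V}) (a b : V).
Hypothesis M : merge G G' phi s S a b.

Lemma degree_fiber C x : degree G' C x = \sum_(v | phi v == x) degree G C v.
Proof.
rewrite big_split /= !(card_preim_sum _ _ (fun v => phi v == x)) /degree.
by congr (_ + _); apply: eq_card => e; rewrite !inE ?(merge_end1 M) ?(merge_end2 M).
Qed.

Lemma merge_neq : b != a.
Proof. by apply: contraNneq (merge_b M) => ->; apply: merge_a M. Qed.

Lemma degree_merged C : degree G' C (phi a) = degree G C a + degree G C b.
Proof.
rewrite degree_fiber (bigD1 a) //= (bigD1 b) /= ?(merge_ab M) ?eqxx ?merge_neq //.
rewrite addnA big1 ?addn0 // => v /andP[/andP[/eqP vb va] nvb].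
by case: (merge_fiber M vb) => [vE | [vE _] | [vE _]]; rewrite vE eqxx in va nvb.
Qed.

Lemma degree_unmerged C v : v != a -> v != b -> degree G' C (phi v) = degree G C v.
Proof.
move=> va vb; rewrite degree_fiber (bigD1 v) //= big1 ?addn0 // => u /andP[/eqP uv].
by case: (merge_fiber M uv) => [-> | [_ vE] | [_ vE]]; rewrite ?vE eqxx in va vb *.
Qed.

Lemma degree_merge_neq0 C v : degree G C v != 0 -> degree G' C (phi v) != 0.
Proof.
rewrite degree_fiber -!lt0n => dv.
by rewrite (bigD1 v) //= (leq_trans dv) // leq_addr.
Qed.

Lemma degree_merge_lift C x :
  degree G' C x != 0 -> exists2 v, phi v = x & degree G C v != 0.
Proof.
rewrite degree_fiber sum_nat_eq0 negb_forall_in => /exists_inP[v /eqP vx dv].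
by exists v.
Qed.

(** Every edge has both ends in [S] or neither, so first ends and second ends contribute equally to
    the sum. *)
Lemma even_degree_side C : ~~ odd (\sum_(v in S) degree G C v).
Proof.
rewrite big_split /= !card_preim_sum.
have -> : [set e in C | end1 G e \in S] = [set e in C | end2 G e \in S].
  by apply/setP=> e; rewrite !inE (merge_closed M).
by rewrite addnn odd_double.
Qed.

(** By the handshake lemma on [S], [a] has even degree in [G]. *)
Lemma degree_split C :
  (forall x, degree G' C x = 0 \/ degree G' C x = 2) ->
  (forall v, degree G C v = 0 \/ degree G C v = 2) /\
  (degree G C a == 0) || (degree G C b == 0).
Proof.
move=> dC.
have d_unm v : v != a -> v != b -> degree G C v = 0 \/ degree G C v = 2.
  by move=> va vb; rewrite -degree_unmerged.
have even_a : ~~ odd (degree G C a).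
  have := even_degree_side C; rewrite (bigD1 a) ?(merge_a M) //= oddD.
  rewrite (_ : odd (\sum_(_ in S | _) _) = false) ?addbF //.
  apply: (big_ind (fun n => odd n = false)) => // [m n|v /andP[vS va]].
    by rewrite oddD => -> ->.
  have vb : v != b by apply: contraNneq (merge_b M) => <-.
  by case: (d_unm v va vb) => ->.
have [da db ab] : [/\ degree G C a = 0 \/ degree G C a = 2,
    degree G C b = 0 \/ degree G C b = 2 & (degree G C a == 0) || (degree G C b == 0)].
  (* The degrees of [a] and [b] add up to 0 or 2, and evenness at [a] rules out the split 1 + 1. *)
  have := dC (phi a); rewrite degree_merged.
  by case: (degree G C a) even_a => [|[|[|n]]] // _;
     case: (degree G C b) => [|[|[|m]]] // []; split; auto.
split=> // v; have [-> // | va] := eqVneq v a.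
by have [-> // | vb] := eqVneq v b; apply: d_unm.
Qed.

Lemma cycles_merge : cycles G' = cycles G.
Proof.
apply/setP=> C; apply/cyclesP/cyclesP => -[nC dC cC]; split=> //.
- by case: (degree_split dC).
- move=> u v du dv; have [_ ab] := degree_split dC.
  have uv := cC _ _ (degree_merge_neq0 du) (degree_merge_neq0 dv).
  (* If [u] and [v] were on opposite sides, the two retractions would connect one of them to [a] and
     the other to [b] within [C], so both [a] and [b] would have nonzero degree. *)
  have crossing p q : degree G C p != 0 -> connect (adj G C) p a ->
      degree G C q != 0 -> connect (adj G C) q b -> False.
    move=> dp pa dq qb; move: ab.
    by rewrite (negbTE (degree_connect pa dp)) (negbTE (degree_connect qb dq)).
  have := connect_retr M uv; have := connect_retr (merge_sym M) uv.
  rewrite /retr !inE; case: (u \in S); case: (v \in S) => //=.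
    by rewrite connect_adj_sym => vb ua; case: (crossing u v).
  by rewrite (connect_adj_sym _ _ a) => ub va; case: (crossing v u).
(* A cycle of [G] is connected and so cannot meet both [a] and [b], which lie on different sides;
   the degrees added at the merged vertex thus include a zero. *)
- have not_both : (degree G C a == 0) || (degree G C b == 0).
    rewrite -[_ || _]negbK negb_or; apply/negP=> /andP[da db].
    have /(connect_side M) := cC a b da db.
    by rewrite (merge_a M) (negbTE (merge_b M)).
  have d_merged : degree G' C (phi a) = 0 \/ degree G' C (phi a) = 2.
    by rewrite degree_merged; case/orP: not_both => /eqP->; rewrite ?addn0; apply: dC.
  move=> x; rewrite -(merge_sectionK M x).
  have [-> // | xa] := eqVneq (s x) a.
  have [-> | xb] := eqVneq (s x) b; first by rewrite -(merge_ab M).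
  by rewrite degree_unmerged.
move=> _ _ /degree_merge_lift[u <- du] /degree_merge_lift[v <- dv].
by apply: (connect_merge M); apply: cC.
Qed.

(** All ingredients of [J0] coincide as sets, in the trivial and the non-trivial case. [the_matroid]
    receives the same predicate on both sides, so its values agree, the default included. *)
Lemma J0_merge (L : {set {set E}}) : J0 G' L = J0 G L.
Proof.
rewrite /J0 /trivial_class /cycle_matroid /J0_cocircuits (bonds_merge M) cycles_merge.
by rewrite (tribonds_merge M) (dibonds_merge M).
Qed.

End MergeCycles.

(** * The two unions of [H] and [K] as an instance of the identification *)

Section GraphUnions.

Variables (VH VK EH EK : finType) (H : graph VH EH) (K : graph VK EK) (h : VH) (k : VK).

Definition identify (v : VH + VK) : VH + {x : VK | x != k} :=
  match v with inl u => inl u | inr w => glue_vertex h k w end.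

(** A section of [identify] that lifts the merged vertex to its copy in [H]. *)
Definition unidentify (x : VH + {x : VK | x != k}) : VH + VK :=
  match x with inl u => inl u | inr w => inr (val w) end.

Lemma glue_vertexP (w : VK) :
  (w = k /\ glue_vertex h k w = inl h) \/
  exists2 y : {x : VK | x != k}, val y = w & glue_vertex h k w = inr y.
Proof.
rewrite /glue_vertex; case: insubP => [y _ yw | /negPn/eqP]; last by left.
by right; exists y.
Qed.

Lemma merge_unions :
  merge (disjoint_union H K) (one_vertex_union H K h k) identify unidentify
    [set v | if v is inl _ then true else false] (inl h) (inr k).
Proof.
have gk : glue_vertex h k k = inl h.
  by case: (glue_vertexP k) => [[] // | [y yk _]]; have := valP y; rewrite yk eqxx.
split; rewrite ?inE //=.
- by case.
- by case.
- move=> [u | w] //=; rewrite /glue_vertex; case: insubP => [y _ /val_inj-> //|].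
  by rewrite (valP w).
(* A vertex of [K] has its image in the [H] summand only if it is [k], whose image is [h]; this
   yields the one nontrivial fibre. *)
- move=> [u | w] [u' | w'] /=.
  + by move=> [->]; constructor 1.
  + by case: (glue_vertexP w') => [[-> ->] [->] | [y _ ->]]; first by constructor 2.
  + by case: (glue_vertexP w) => [[-> ->] [<-] | [y _ ->]]; first by constructor 3.
  case: (glue_vertexP w) => [[-> ->] | [y <- ->]];
    case: (glue_vertexP w') => [[-> ->] | [z <- ->]] //.
    by constructor 1.
  by move=> [->]; constructor 1.
by case=> e; rewrite !inE.
Qed.

End GraphUnions.

Theorem theorem3p12
  (VH EH VK EK : finType) (H : graph VH EH) (K : graph VK EK)
  (h : VH) (k : VK) (L : {set {set (EH + EK)%type}}) :
  (linear_class (one_vertex_union H K h k) L <->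
   linear_class (disjoint_union H K) L) /\
  (linear_class (one_vertex_union H K h k) L ->
   J0 (one_vertex_union H K h k) L = J0 (disjoint_union H K) L /\
   J (one_vertex_union H K h k) L = J (disjoint_union H K) L).
Proof.
have M := merge_unions H K h k.
split; first exact: linear_class_merge M.
by rewrite /J (J0_merge M).
Qed.
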